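(* Let $P=[g]=[g_\infty,1]\in(\Gamma_\infty\Gamma\backslash G(\mathbb A))/G(\mathbb Q)\subseteq X_\Gamma(\mathbb C)$, and let $[P]$ be its $\mathbb C$-isogeny class. Then the following map is a (well-defined) bijection: $$\psi_{g_\infty}:\Gamma\backslash G(\mathbb A_f)/\mathrm{End}^0(A_g,\imath_g)^\times\stackrel{\simeq}{\longrightarrow}[P];\qquad g_f\longmapsto[g_\infty,g_f].$$
   Context: **Quaternions.** $B$ is an indefinite quaternion algebra over $\mathbb Q$ (possibly $M_2(\mathbb Q)$), with a fixed identification $B\otimes\mathbb R=M_2(\mathbb R)$; $\mathcal O_0\subset B$ is a maximal order; $\hat{\mathcal O}_0=\mathcal O_0\otimes\hat{\mathbb Z}$; $\mathbb A_f=\hat{\mathbb Z}\otimes\mathbb Q$ and $\mathbb A$ are the finite adeles and adeles of $\mathbb Q$. $G(R)=(\mathcal O_0^{opp}\otimes R)^\times$; elements of $G(\mathbb A_f)$ act on the right, and products, cosets and double cosets are formed with the multiplication of $B\otimes\mathbb A_f$ (resp. $B\otimes\mathbb A$). $\mathrm{End}^0=\mathrm{End}\otimes\mathbb Q$. **QM surfaces.** An abelian surface with QM by $\mathcal O_0$ over $F$ is a pair $(A,\imath)$, $A/F$ an abelian surface and $\imath:\mathcal O_0\hookrightarrow\mathrm{End}_F(A)$ an embedding with $\imath(B)\cap\mathrm{End}_F(A)=\imath(\mathcal O_0)$. $\mathrm{End}(A,\imath)$ is the ring of endomorphisms commuting with $\imath(\mathcal O_0)$. $(A',\imath')$ and $(A,\imath)$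 are isogenous if there is an isogeny $\mu:A'\to A$ with $\mu\circ\imath'(\alpha)=\imath(\alpha)\circ\mu$ for all $\alpha\in\mathcal O_0$. **Shimura curve.** $\Gamma$ is an open subgroup of $\hat{\mathcal O}_0^\times$. $\mathcal O_0$-isomorphisms $\varphi,\varphi':A_{tor}\to B/\mathcal O_0$ are $\Gamma$-equivalent if $\varphi'=\varphi\gamma$ with $\gamma\in\Gamma$. $X_\Gamma$ is the compactification (only needed if $B\simeq M_2(\mathbb Q)$) of the coarse moduli space of triples $(A,\imath,\bar\varphi)$ with $(A,\imath)$ an abelian surface with QM by $\mathcal O_0$ and $\bar\varphi$ a $\Gamma$-equivalence class of $\mathcal O_0$-isomorphisms $A_{tor}\to B/\mathcal O_0$. One has $$X_\Gamma(\mathbb C)=(\Gamma_\infty\Gamma\backslash G(\mathbb A))/G(\mathbb Q)\cup\{\text{cusps}\},\quad \Gamma_\infty=\left\{\begin{pmatrix}a&b\\-b&a\end{pmatrix}\in\mathrm{GL}_2(\mathbb R)\right\}.$$ The class of $g=(g_\infty,g_f)$ corresponds to $(A_g,\imath_g,\bar\varphi_g)$, where $A_g=(B\otimes\mathbb R)_{g_\infty}/I_{g_f}$, $I_{g_f}=\hat{\mathcal O}_0g_f\cap B$, and $(B\otimes\mathbb R)_{g_\infty}$ is $M_2(\mathbb R)$ with complex structure given by right multiplication via $h_{g_\infty}:\mathbb C\to M_2(\mathbb R)$, $i\mapsto g_\infty^{-1}\begin{pmatrix}0&1\\-1&0\end{pmatrix}g_\infty$; $\imath_g(\alpha)(b\otimes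 z)=\alpha b\otimes z$; and $\varphi_g:(A_g)_{tor}=B/I_{g_f}\to B/\mathcal O_0$, $b\mapsto bg_f^{-1}$. With these descriptions $\mathrm{End}^0(A_g,\imath_g)^\times=\{\gamma\in G(\mathbb Q):g_\infty\gamma g_\infty^{-1}\in\Gamma_\infty\}$, which is viewed in $G(\mathbb A_f)$ via $G(\mathbb Q)\subset G(\mathbb A_f)$. **Isogeny class.** If $P$ corresponds to $(A,\imath,\bar\varphi)$, $[P]\subset X_\Gamma(\mathbb C)$ is the set of points corresponding to triples $(A',\imath',\bar\varphi')/\mathbb C$ with $(A',\imath')$ isogenous to $(A,\imath)$. *)

(* Defs.v *)
From HB Require Import structures.
From mathcomp Require Import all_boot all_order all_algebra generic_quotient.
From mathcomp Require Import ring.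
From mathcomp Require Import complex.
From mathcomp Require Import boolp classical_sets functions cardinality reals.

Set Implicit Arguments.
Unset Strict Implicit.
Unset Printing Implicit Defensive.

Import Order.TTheory GRing.Theory Num.Theory.
Local Open Scope classical_set_scope.
Local Open Scope ring_scope.

(* Classical inverses: an element is declared a unit as soon as it has a
   two-sided inverse. *)
Section ClassicalUnits.
Variable A : nzRingType.

Definition has_inv (x : A) : Prop := exists y, y * x = 1 /\ x * y = 1.
Definition cunit : {pred A} := fun x => `[< has_inv x >].
Definition cinv (x : A) : A :=
  if pselect (has_inv x) is left h then projT1 (cid h) else x.

Lemma cinvP x : x \in cunit -> cinv x * x = 1 /\ x * cinv x = 1.
Proof.
move=> /asboolP h; rewrite /cinv; case: pselect => // h'.
exact: (projT2 (cid h')).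
Qed.

Lemma cmulVr : {in cunit, left_inverse 1 cinv *%R}.
Proof. by move=> x /cinvP[]. Qed.
Lemma cdivrr : {in cunit, right_inverse 1 cinv *%R}.
Proof. by move=> x /cinvP[]. Qed.
Lemma cunitP (x y : A) : y * x = 1 /\ x * y = 1 -> cunit x.
Proof. by move=> h; apply/asboolP; exists y. Qed.
Lemma cinv_out : {in [predC cunit], cinv =1 id}.
Proof.
move=> x; rewrite inE => /asboolP h; rewrite /cinv; by case: pselect.
Qed.
End ClassicalUnits.

(* The profinite integers, as the inverse limit of the rings Z/m over the
   moduli m = n.+2 >= 2 ('I_n.+2 is Z/(n+2)), ordered by divisibility. *)
Section Zhat.

Definition coherent (x : forall n, 'I_n.+2) : Prop :=
  forall m n, (n.+2 %| m.+2)%N -> inZp (x m) = x n.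

Record Zhat := MkZhat { zhat :> forall n, 'I_n.+2; zhatP : coherent zhat }.

Lemma zhat_inj (x y : Zhat) : (forall n, x n = y n) -> x = y.
Proof.
case: x y => [x hx] [y hy] /= e.
have {}e : x = y by apply: functional_extensionality_dep.
by subst y; congr MkZhat; exact: Prop_irrelevance.
Qed.

HB.instance Definition _ := gen_eqMixin Zhat.
HB.instance Definition _ := gen_choiceMixin Zhat.

Lemma coherent0 : coherent (fun n => 0).
Proof. by move=> m n _; apply: val_inj; rewrite /= mod0n. Qed.
Lemma coherent1 : coherent (fun n => 1).
Proof. by move=> m n _; apply: val_inj; rewrite /= !modn_small. Qed.
Lemma inZpD m n (x y : 'I_m.+2) : (n.+2 %| m.+2)%N ->
  inZp (x + y : 'I_m.+2)%R = inZp x + inZp y :> 'I_n.+2.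
Proof. by move=> d; apply: val_inj; rewrite /= (modn_dvdm _ d) modnDm. Qed.
Lemma coherentD (x y : Zhat) : coherent (fun n => x n + y n).
Proof. by move=> m n d; rewrite inZpD // (zhatP x d) (zhatP y d). Qed.
Lemma coherentN (x : Zhat) : coherent (fun n => - x n).
Proof.
move=> m n d; apply: (addIr (inZp (x m))); rewrite -inZpD // addNr.
by rewrite (zhatP x d) addNr; apply: val_inj; rewrite /= mod0n.
Qed.
Lemma coherentM (x y : Zhat) : coherent (fun n => x n * y n).
Proof.
move=> m n d; apply: val_inj.
by rewrite /= -(zhatP x d) -(zhatP y d) /= (modn_dvdm _ d) modnMm.
Qed.

Definition Zhat0 := MkZhat coherent0.
Definition Zhat1 := MkZhat coherent1.
Definition Zhat_opp x := MkZhat (coherentN x).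
Definition Zhat_add x y := MkZhat (coherentD x y).
Definition Zhat_mul x y := MkZhat (coherentM x y).

Fact Zhat_addA : associative Zhat_add.
Proof. by move=> x y z; apply: zhat_inj => n; exact: addrA. Qed.
Fact Zhat_addC : commutative Zhat_add.
Proof. by move=> x y; apply: zhat_inj => n; exact: addrC. Qed.
Fact Zhat_add0 : left_id Zhat0 Zhat_add.
Proof. by move=> x; apply: zhat_inj => n; exact: add0r. Qed.
Fact Zhat_addN : left_inverse Zhat0 Zhat_opp Zhat_add.
Proof. by move=> x; apply: zhat_inj => n; exact: addNr. Qed.
HB.instance Definition _ :=
  GRing.isZmodule.Build Zhat Zhat_addA Zhat_addC Zhat_add0 Zhat_addN.

Fact Zhat_mulA : associative Zhat_mul.
Proof. by move=> x y z; apply: zhat_inj => n; exact: mulrA. Qed.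
Fact Zhat_mulC : commutative Zhat_mul.
Proof. by move=> x y; apply: zhat_inj => n; exact: mulrC. Qed.
Fact Zhat_mul1 : left_id Zhat1 Zhat_mul.
Proof. by move=> x; apply: zhat_inj => n; exact: mul1r. Qed.
Fact Zhat_mulD : left_distributive Zhat_mul Zhat_add.
Proof. by move=> x y z; apply: zhat_inj => n; exact: mulrDl. Qed.
Fact Zhat_1neq0 : Zhat1 != 0.
Proof. by apply/eqP => /(congr1 (fun x : Zhat => val (x 0%N))). Qed.
HB.instance Definition _ := GRing.Zmodule_isComNzRing.Build Zhat
  Zhat_mulA Zhat_mulC Zhat_mul1 Zhat_mulD Zhat_1neq0.

Lemma zhat_natE k n : ((k%:R : Zhat) n : 'I_n.+2) = k%:R.
Proof. by elim: k => // k IH; rewrite -natr1 -[RHS]natr1 -IH. Qed.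

Lemma Zhat_torsion_free (x : Zhat) k : x * k.+1%:R = 0 -> x = 0.
Proof.
move=> h; apply: zhat_inj => n; apply: val_inj => /=.
have [M eM] : exists M, M.+2 = (k.+1 * n.+2)%N.
  by exists (n + k * n.+2)%N; rewrite mulSn !addSn.
have d : (n.+2 %| M.+2)%N by rewrite eM dvdn_mull.
have := congr1 (fun y : Zhat => val (y M)) h.
rewrite /= zhat_natE Zp_nat /= modnMmr -(zhatP x d) /= => /eqP.
by move: (nat_of_ord (x M)) => t; rewrite -/(dvdn _ _) eM mulnC dvdn_pmul2r // => /eqP.
Qed.

Lemma Zhat_mulnI k : injective (fun x : Zhat => x * k.+1%:R).
Proof.
move=> x y /eqP; rewrite -subr_eq0 -mulrBl => /eqP /Zhat_torsion_free /eqP.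
by rewrite subr_eq0 => /eqP.
Qed.
End Zhat.

(* The finite adeles Zhat (x) Q: fractions x / n.+1 with x in Zhat, coded by
   the pairs (x, n). *)
Section FiniteAdeles.
Local Open Scope quotient_scope.

Definition fa_eq (x y : Zhat * nat) : bool :=
  x.1 * y.2.+1%:R == y.1 * x.2.+1%:R.

Fact fa_eq_refl : reflexive fa_eq. Proof. by move=> x; rewrite /fa_eq. Qed.
Fact fa_eq_sym : symmetric fa_eq.
Proof. by move=> x y; rewrite /fa_eq eq_sym. Qed.
Fact fa_eq_trans : transitive fa_eq.
Proof.
move=> y x z /eqP xy /eqP yz; apply/eqP; apply: (@Zhat_mulnI y.2).
by rewrite mulrAC xy mulrAC yz mulrAC.
Qed.
Canonical fa_equiv := EquivRel fa_eq fa_eq_refl fa_eq_sym fa_eq_trans.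

Definition Af := {eq_quot fa_eq}.
HB.instance Definition _ : EqQuotient _ fa_eq Af := EqQuotient.on Af.
HB.instance Definition _ := Choice.on Af.

Local Notation frac := (Zhat * nat)%type.

Definition pmul1 (m n : nat) : nat := (m.+1 * n.+1).-1.
Lemma pmul1E m n : (pmul1 m n).+1%:R = m.+1%:R * n.+1%:R :> Zhat.
Proof. by rewrite /pmul1 prednK // natrM. Qed.

Definition Zhat_Af := lift_embed Af (fun x : Zhat => (x, 0%N)).
Canonical Zhat_Af_pi := PiEmbed Zhat_Af.

Lemma fa_reprP (x : frac) :
  x.1 * (repr (\pi_Af x)).2.+1%:R = (repr (\pi_Af x)).1 * x.2.+1%:R.
Proof.
by apply/eqP; rewrite -/(fa_eq x (repr (\pi_Af x))) -eqmodE reprK.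
Qed.

Definition fa_add (x y : frac) : frac :=
  (x.1 * y.2.+1%:R + y.1 * x.2.+1%:R, pmul1 x.2 y.2).
Definition Af_add := lift_op2 Af fa_add.
Fact pi_Af_add : {morph \pi : x y / fa_add x y >-> Af_add x y}.
Proof.
move=> x y; unlock Af_add; apply/eqmodP; rewrite /= /fa_eq /fa_add /= !pmul1E.
move: (fa_reprP x) (fa_reprP y).
move: (repr (\pi_Af x)) (repr (\pi_Af y)) => u v ex ey; apply/eqP.
transitivity (x.1 * u.2.+1%:R * (y.2.+1%:R * v.2.+1%:R)
  + y.1 * v.2.+1%:R * (x.2.+1%:R * u.2.+1%:R)); first by ring.
by rewrite ex ey; ring.
Qed.
Canonical pi_Af_add_morph := PiMorph2 pi_Af_add.

Definition fa_opp (x : frac) : frac := (- x.1, x.2).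
Definition Af_opp := lift_op1 Af fa_opp.
Fact pi_Af_opp : {morph \pi : x / fa_opp x >-> Af_opp x}.
Proof.
move=> x; unlock Af_opp; apply/eqmodP; rewrite /= /fa_eq /fa_opp /= !mulNr.
by rewrite fa_reprP.
Qed.
Canonical pi_Af_opp_morph := PiMorph1 pi_Af_opp.

Definition fa_mul (x y : frac) : frac := (x.1 * y.1, pmul1 x.2 y.2).
Definition Af_mul := lift_op2 Af fa_mul.
Fact pi_Af_mul : {morph \pi : x y / fa_mul x y >-> Af_mul x y}.
Proof.
move=> x y; unlock Af_mul; apply/eqmodP; rewrite /= /fa_eq /fa_mul /= !pmul1E.
move: (fa_reprP x) (fa_reprP y).
move: (repr (\pi_Af x)) (repr (\pi_Af y)) => u v ex ey; apply/eqP.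
transitivity (x.1 * u.2.+1%:R * (y.1 * v.2.+1%:R)); first by ring.
by rewrite ex ey; ring.
Qed.
Canonical pi_Af_mul_morph := PiMorph2 pi_Af_mul.

Ltac fa_eq_tac := apply/eqmodP;
  rewrite /= /fa_eq /fa_add /fa_mul /fa_opp /= ?pmul1E; apply/eqP; ring.

Fact Af_addA : associative Af_add.
Proof. by do 3!elim/quotW=> ?; rewrite !piE; fa_eq_tac. Qed.
Fact Af_addC : commutative Af_add.
Proof. by do 2!elim/quotW=> ?; rewrite !piE; fa_eq_tac. Qed.
Fact Af_add0 : left_id (Zhat_Af 0) Af_add.
Proof. by elim/quotW=> ?; rewrite !piE; fa_eq_tac. Qed.
Fact Af_addN : left_inverse (Zhat_Af 0) Af_opp Af_add.
Proof. by elim/quotW=> ?; rewrite !piE; fa_eq_tac. Qed.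
HB.instance Definition _ :=
  GRing.isZmodule.Build Af Af_addA Af_addC Af_add0 Af_addN.

Fact Af_mulA : associative Af_mul.
Proof. by do 3!elim/quotW=> ?; rewrite !piE; fa_eq_tac. Qed.
Fact Af_mulC : commutative Af_mul.
Proof. by do 2!elim/quotW=> ?; rewrite !piE; fa_eq_tac. Qed.
Fact Af_mul1 : left_id (Zhat_Af 1) Af_mul.
Proof. by elim/quotW=> ?; rewrite !piE; fa_eq_tac. Qed.
Fact Af_mulD : left_distributive Af_mul Af_add.
Proof. by do 3!elim/quotW=> ?; rewrite !piE; fa_eq_tac. Qed.
Fact Af_1neq0 : Zhat_Af 1 != Zhat_Af 0.
Proof. by rewrite piE /fa_eq /= !mulr1 oner_eq0. Qed.
HB.instance Definition _ := GRing.Zmodule_isComNzRing.Build Af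
  Af_mulA Af_mulC Af_mul1 Af_mulD Af_1neq0.
HB.instance Definition _ := GRing.NzRing_hasMulInverse.Build Af
  (@cmulVr Af) (@cdivrr Af) (@cunitP Af) (@cinv_out Af).

Fact Zhat_Af_is_zmod_morphism : zmod_morphism Zhat_Af.
Proof. by move=> x y; rewrite !piE; fa_eq_tac. Qed.
Fact Zhat_Af_is_monoid_morphism : monoid_morphism Zhat_Af.
Proof. by split=> // x y; rewrite !piE; fa_eq_tac. Qed.
HB.instance Definition _ :=
  GRing.isZmodMorphism.Build Zhat Af Zhat_Af Zhat_Af_is_zmod_morphism.
HB.instance Definition _ :=
  GRing.isMonoidMorphism.Build Zhat Af Zhat_Af Zhat_Af_is_monoid_morphism.

(* Hence Af contains Q, through ratr. *)
Lemma Af_natr_unit n : (n.+1%:R : Af) \is a GRing.unit.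
Proof.
apply/unitrP; exists (\pi_Af (1, n)).
suff e : \pi_Af (1, n) * n.+1%:R = 1 :> Af by split=> //; rewrite mulrC.
rewrite -(rmorph_nat Zhat_Af n.+1) -[RHS](rmorph1 Zhat_Af).
change (Af_mul (\pi_Af (1, n)) (Zhat_Af n.+1%:R) = Zhat_Af 1).
rewrite !piE; fa_eq_tac.
Qed.
End FiniteAdeles.

(* The quaternion algebra (a, b / A): basis 1, i, j, ij with i^2 = a, j^2 = b
   and ij = -ji. *)
Record quat (A : Type) (a b : A) := Quat { q1 : A; qi : A; qj : A; qk : A }.
Arguments Quat {A a b}.

Section QuatRing.
Variables (A : comNzRingType) (a b : A).
Local Notation H := (quat a b).

Definition quat_tuple (x : H) := (q1 x, qi x, qj x, qk x).
Definition tuple_quat (t : A * A * A * A) : H :=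
  let: (x, y, z, w) := t in Quat x y z w.
Lemma quat_tupleK : cancel quat_tuple tuple_quat. Proof. by case. Qed.
HB.instance Definition _ := Choice.copy H (can_type quat_tupleK).

Definition quat_add (x y : H) : H :=
  Quat (q1 x + q1 y) (qi x + qi y) (qj x + qj y) (qk x + qk y).
Definition quat_opp (x : H) : H := Quat (- q1 x) (- qi x) (- qj x) (- qk x).
Definition quat_scale (c : A) (x : H) : H :=
  Quat (c * q1 x) (c * qi x) (c * qj x) (c * qk x).
Definition quat_mul (x y : H) : H := Quat
  (q1 x * q1 y + a * (qi x * qi y) + b * (qj x * qj y)
   - a * b * (qk x * qk y))
  (q1 x * qi y + qi x * q1 y - b * (qj x * qk y) + b * (qk x * qj y))
  (q1 x * qj y + qj x * q1 y + a * (qi x * qk y) - a * (qk x * qi y))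
  (q1 x * qk y + qk x * q1 y + qi x * qj y - qj x * qi y).
Definition quat_one : H := Quat 1 0 0 0.

Ltac quat_tac := intros;
  repeat match goal with x : quat _ _ |- _ => destruct x end;
  rewrite /quat_add /quat_opp /quat_scale /quat_mul /quat_one /=;
  congr Quat; ring.

Fact quat_addA : associative quat_add. Proof. by move=> ???; quat_tac. Qed.
Fact quat_addC : commutative quat_add. Proof. by move=> ??; quat_tac. Qed.
Fact quat_add0 : left_id (Quat 0 0 0 0) quat_add.
Proof. by move=> ?; quat_tac. Qed.
Fact quat_addN : left_inverse (Quat 0 0 0 0) quat_opp quat_add.
Proof. by move=> ?; quat_tac. Qed.
HB.instance Definition _ :=
  GRing.isZmodule.Build H quat_addA quat_addC quat_add0 quat_addN.

Fact quat_mulA : associative quat_mul. Proof. by move=> ???; quat_tac. Qed.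
Fact quat_mul1l : left_id quat_one quat_mul. Proof. by move=> ?; quat_tac. Qed.
Fact quat_mul1r : right_id quat_one quat_mul.
Proof. by move=> ?; quat_tac. Qed.
Fact quat_mulDl : left_distributive quat_mul quat_add.
Proof. by move=> ???; quat_tac. Qed.
Fact quat_mulDr : right_distributive quat_mul quat_add.
Proof. by move=> ???; quat_tac. Qed.
Fact quat_1neq0 : quat_one != 0.
Proof. by apply/eqP => /(congr1 (@q1 _ _ _)) /eqP; rewrite /= oner_eq0. Qed.
HB.instance Definition _ := GRing.Zmodule_isNzRing.Build H
  quat_mulA quat_mul1l quat_mul1r quat_mulDl quat_mulDr quat_1neq0.
HB.instance Definition _ := GRing.NzRing_hasMulInverse.Build H
  (@cmulVr H) (@cdivrr H) (@cunitP H) (@cinv_out H).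

Fact quat_scaleA c d (x : H) :
  quat_scale c (quat_scale d x) = quat_scale (c * d) x.
Proof. by quat_tac. Qed.
Fact quat_scale1 : left_id 1 quat_scale. Proof. by move=> ?; quat_tac. Qed.
Fact quat_scaleDr : right_distributive quat_scale +%R.
Proof. by move=> c x y; rewrite /GRing.add /=; quat_tac. Qed.
Fact quat_scaleDl (x : H) : {morph quat_scale^~ x : c d / c + d}.
Proof. by move=> c d; rewrite [RHS]/GRing.add /=; quat_tac. Qed.
HB.instance Definition _ := GRing.Zmodule_isLmodule.Build A H
  quat_scaleA quat_scale1 quat_scaleDr quat_scaleDl.
Fact quat_scaleAl c (x y : H) : c *: (x * y) = c *: x * y.
Proof. by rewrite /GRing.scale /GRing.mul /=; quat_tac. Qed.
HB.instance Definition _ := GRing.Lmodule_isLalgebra.Build A H quat_scaleAl.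
End QuatRing.

(* For B = (a, b / Q), scalar extension to a ring A containing Q only changes
   the ring of coordinates: B (x) A = (a, b / A), with b |-> b (x) 1 given by
   quat_ext. *)
Notation quat_over A a b := (quat (ratr a : A) (ratr b)).

Definition quat_ext (A : comUnitRingType) (a b : rat) (x : quat a b) :
    quat_over A a b :=
  Quat (ratr (q1 x)) (ratr (qi x)) (ratr (qj x)) (ratr (qk x)).
Arguments quat_ext A {a b} x.

Section Orders.
Variables a b : rat.
Local Notation B := (quat a b).
Local Notation Bf := (quat_over Af a b).

(* A full Z-lattice in B that is a subring. *)
Definition is_order (O : set B) : Prop :=
  [/\ O 1,
      forall x y, O x -> O y -> O (x - y) /\ O (x * y),
      exists n (e : 'I_n -> B),
        O = range (fun c : 'I_n -> int => \sum_i e i *~ c i) &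
      forall x, exists2 n, (0 < n)%N & O (x *+ n)].

Definition maximal_order (O : set B) : Prop :=
  is_order O /\ forall O', is_order O' -> O `<=` O' -> O' = O.

(* O (x) Zhat, as the Zhat-span of O in B (x) Af. *)
Definition hat (O : set B) : set Bf :=
  [set x | exists s : seq (Zhat * B),
     (forall p, p \in s -> O p.2) /\
     x = \sum_(p <- s) Zhat_Af p.1 *: quat_ext Af p.2].

Definition hat_units (O : set B) : set Bf :=
  [set u | u \is a GRing.unit /\ hat O u /\ hat O u^-1].

(* Openness is for the profinite topology of hat O, whose basic neighbourhoods
   of u are the sets u + N hat O with N > 0. *)
Definition open_subgroup (O : set B) (G : set Bf) : Prop :=
  [/\ G `<=` hat_units O,
      G 1,
      forall u v, G u -> G v -> G (u * v),
      forall u, G u -> G u^-1 &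
      forall u, G u -> exists2 N, (0 < N)%N &
        forall v, hat_units O v ->
          (exists2 w, hat O w & v - u = w *+ N) -> G v].

(* I_g = hat O g :&: B *)
Definition ideal_of (O : set B) (g : Bf) : set B :=
  [set x | exists2 y, hat O y & quat_ext Af x = y * g].
End Orders.

(* The double coset H x K and the set H \ X / K. *)
Definition dcoset (T : nzRingType) (H K : set T) (x : T) : set T :=
  [set h * x * k | h in H & k in K].
Definition dcosets (T : nzRingType) (H K X : set T) : set (set T) :=
  dcoset H K @` X.

(* Complex tori V / L with an action of B on V by (quasi-)endomorphisms. *)
Record qm_torus (R : realType) (B : Type) := QMTorus {
  lie : lmodType R[i];
  period : set lie;
  qm : B -> lie -> lie }.

Section QMTori.
Variables (R : realType) (a b : rat).
Local Notation B := (quat a b).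
Variable O : set B.
Local Notation torus := (qm_torus R B).

(* Homomorphisms V / L -> V' / L' of complex tori are induced by the C-linear
   maps F : V -> V' such that F(L) is contained in L'. *)
Definition is_hom (A A' : torus) (F : lie A -> lie A') : Prop :=
  [/\ linear F,
      forall x, period x -> period (F x) &
      forall alpha, O alpha -> forall x, F (qm alpha x) = qm alpha (F x)].

(* The induced map V / L -> V' / L' is onto, with finite kernel F^-1(L') / L;
   the elements of this kernel are the cosets v + L. *)
Definition is_isogeny (A A' : torus) (F : lie A -> lie A') : Prop :=
  [/\ is_hom F,
      forall y, exists x, period (y - F x) &
      finite_set [set [set v + l | l in @period _ _ A] |
                    v in [set v | period (F v)]]].

Definition isogenous (A A' : torus) : Prop :=
  exists F : lie A -> lie A', is_isogeny F.

(* End(A, i) (x) Q, inside the C-linear endomorphisms of V. *)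
Definition End0 (A : torus) : set (lie A -> lie A) :=
  [set F | exists2 n, (0 < n)%N & is_hom (fun x => F x *+ n)].

Definition End0_units (A : torus) : set (lie A -> lie A) :=
  [set F | End0 F /\ exists2 F', End0 F' & cancel F F' /\ cancel F' F].
End QMTori.

Section ComplexStructure.
Variable R : realType.

(* The embedding of C in M_2(R) with 'i |-> (0, 1; -1, 0). *)
Definition rot (z : R[i]) : 'M[R]_2 :=
  \matrix_(i, j) if i == j then complex.Re z
                 else if i == 0 then complex.Im z else - complex.Im z.

(* Only the nonzero matrices of this shape are invertible. *)
Definition Gamma_inf : set 'M[R]_2 := [set c | c \is a GRing.unit] `&` range rot.

Definition cplx (g : 'M[R]_2) (z : R[i]) : 'M[R]_2 := g^-1 * rot z * g.

Fact rot_is_zmod_morphism : zmod_morphism rot.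
Proof.
move=> [x y] [u v]; apply/matrixP=> i j; rewrite !mxE /=.
by case: ifP => // _; case: ifP => // _; rewrite opprD.
Qed.

Fact rot_is_monoid_morphism : monoid_morphism rot.
Proof.
split=> [|[x y] [u v]]; apply/matrixP=> i j; rewrite !mxE /=.
  by case: ifP => // _; case: ifP => // _; rewrite oppr0.
rewrite !big_ord_recl big_ord0 !mxE /=.
by case: i => [[|[|//]] hi]; case: j => [[|[|//]] hj] /=; ring.
Qed.

(* M_2(R), with z acting by right multiplication by h_g(z) = cplx g z. *)
Definition M2 (g : 'M[R]_2) (hg : g \is a GRing.unit) : Type := 'M[R]_2.

Section M2.
Variables (g : 'M[R]_2) (hg : g \is a GRing.unit).
HB.instance Definition _ := GRing.Zmodule.on (M2 hg).

Definition M2_scale (z : R[i]) (v : M2 hg) : M2 hg :=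
  (v : 'M[R]_2) * cplx g z.

Fact M2_scaleA z w v : M2_scale z (M2_scale w v) = M2_scale (z * w) v.
Proof.
rewrite /M2_scale /cplx [z * w]mulrC rot_is_monoid_morphism.2 !mulrA.
by rewrite (mulrK hg).
Qed.
Fact M2_scale1 : left_id 1 M2_scale.
Proof.
move=> v; rewrite /M2_scale /cplx rot_is_monoid_morphism.1 mulr1.
by rewrite (mulVr hg) mulr1.
Qed.
Fact M2_scaleDr : right_distributive M2_scale +%R.
Proof. by move=> z u v; exact: mulrDl. Qed.
Fact M2_scaleDl v : {morph M2_scale^~ v : z w / z + w}.
Proof.
move=> z w; rewrite /M2_scale /cplx -mulrDr -mulrDl -mulrDr.
congr (_ * (_ * _ * _)); have N u : rot (- u) = - rot u.
  by rewrite -[- u]add0r rot_is_zmod_morphism -(subrr 0) rot_is_zmod_morphism subrr sub0r.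
by rewrite -[w in LHS]opprK rot_is_zmod_morphism N opprK.
Qed.
HB.instance Definition _ := GRing.Zmodule_isLmodule.Build R[i] (M2 hg)
  M2_scaleA M2_scale1 M2_scaleDr M2_scaleDl.
End M2.
End ComplexStructure.

Section Shimura.
Variables (R : realType) (a b : rat).
Local Notation B := (quat a b).
Local Notation Bf := (quat_over Af a b).
(* the identification of B (x) R with M_2(R) *)
Variable phi : quat_over R a b -> 'M[R]_2.
Variables (O : set B) (G : set Bf).

(* (A_g, i_g) for g = (ginf, gf). *)
Definition QM (ginf : 'M[R]_2) (hg : ginf \is a GRing.unit) (gf : Bf) :
    qm_torus R B :=
  @QMTorus R B (M2 hg)
    ((phi \o quat_ext R) @` ideal_of O gf)
    (fun alpha v => phi (quat_ext R alpha) * (v : 'M[R]_2)).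

(* The point of X_Gamma(C) given by (ginf, gf) is its double coset in
   (Gamma_inf Gamma \ G(A)) / G(Q), where G(A) is the set of units of
   M_2(R) x (B (x) Af). *)
Definition GQ : set ('M[R]_2 * Bf)%type :=
  [set (phi (quat_ext R x), quat_ext Af x) | x in [set x : B | x \is a GRing.unit]].
Definition X_point (g : 'M[R]_2 * Bf) : set ('M[R]_2 * Bf)%type :=
  dcoset (@Gamma_inf R `*` G) GQ g.

(* The isogeny class [P] of a (non-cuspidal) point P. *)
Definition isogeny_class (P : set ('M[R]_2 * Bf)%type) :
    set (set ('M[R]_2 * Bf)%type) :=
  [set Q | exists ginf (hg : ginf \is a GRing.unit) gf
                  ginf' (hg' : ginf' \is a GRing.unit) gf',
     [/\ gf \is a GRing.unit, P = X_point (ginf, gf),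
         gf' \is a GRing.unit, Q = X_point (ginf', gf') &
         isogenous O (QM hg' gf') (QM hg gf)]].

(* End0(A_g, i_g)^x for g = (ginf, gf), as a subgroup of G(Q) viewed in G(Af);
   c in G(Q) acts on A_g by right multiplication. *)
Definition End0_Af (ginf : 'M[R]_2) (hg : ginf \is a GRing.unit) (gf : Bf) :
    set Bf :=
  [set quat_ext Af c | c in [set c : B | c \is a GRing.unit /\
     End0_units O (A := QM hg gf)
       (fun v : M2 hg => (v : 'M[R]_2) * phi (quat_ext R c))]].
End Shimura.

(* Main.v *)
(** Two pairs (g, u) and (g, u') give the same point iff u' lies in
    Gam u c for some c in B^x whose conjugate by g lies in Gamma_inf, that is,
    commutes with the complex structure; these c are the units of
    End^0(A_g, i_g), since some multiple of right multiplication by c preserves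
    the lattice. This gives well-definedness and injectivity. Multiplication by
    a suitable integer is an isogeny from (g, u) to (g, 1), because the lattices
    involved are commensurable. Conversely, an isogeny F from (g2, u2) to
    (g1, u1) commutes with O, hence with M_2(R), so it is right multiplication
    by m = F(1); as m carries a nonzero integer of one lattice into the other,
    m is the image of some c in B, a unit because the kernel of F on the tori is
    finite. C-linearity of F says that g2 c g1^-1 is in Gamma_inf, so
    (g2, u2) and (g1, u2 c) define the same point. *)
Require Import Defs.
From HB Require Import structures.
From mathcomp Require Import all_boot all_order all_algebra.
From mathcomp Require Import boolp classical_sets functions cardinality reals.
From mathcomp Require Import generic_quotient complex ring zify.

Set Implicit Arguments.
Unset Strict Implicit.
Unset Printing Implicit Defensive.

Import Order.TTheory GRing.Theory Num.Theory.
Local Open Scope classical_set_scope.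
Local Open Scope ring_scope.

(** * Rational scalars *)

Section RationalScalars.
Variable A : comUnitRingType.
Hypothesis natA : forall n, (n.+1%:R : A) \is a GRing.unit.

Lemma intr_unit_char0 (d : int) : d != 0 -> (d%:~R : A) \is a GRing.unit.
Proof. by case: d => [[|n]|n] //= _; rewrite ?NegzE ?mulrNz ?unitrN; exact: natA. Qed.

(** [ratr] uses the reduced fraction; cross-multiplying in the integers shows that any fraction n /
    d representing [x] gives the same value, so sums and products can be checked over a common
    denominator. *)
Lemma ratr_fracE (x : rat) (n d : int) :
  x * d%:~R = n%:~R -> (ratr x : A) * d%:~R = n%:~R.
Proof.
move=> h; have den_unit := intr_unit_char0 (denq_neq0 x).
have /eqP : (numq x * d)%:~R = (n * denq x)%:~R :> rat.
  by rewrite !intrM numqE -h; ring.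
rewrite eqr_int => /eqP /(congr1 (fun z : int => z%:~R : A)).
rewrite !intrM => h'; apply: (mulIr den_unit).
by rewrite -h' /ratr [LHS]mulrAC divrK.
Qed.

Lemma ratr_char0_zmod_morphism : zmod_morphism (@ratr A).
Proof.
move=> x y; pose d := denq x * denq y.
have d_unit : (d%:~R : A) \is a GRing.unit.
  by apply: intr_unit_char0; rewrite mulf_neq0 ?denq_neq0.
have hx : x * d%:~R = (numq x * denq y)%:~R by rewrite !intrM numqE; ring.
have hy : y * d%:~R = (numq y * denq x)%:~R by rewrite !intrM numqE; ring.
apply: (mulIr d_unit).
rewrite mulrBl (ratr_fracE hx) (ratr_fracE hy) -rmorphB.
by apply: ratr_fracE; rewrite mulrBl hx hy rmorphB.
Qed.

Lemma ratr_char0_monoid_morphism : monoid_morphism (@ratr A).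
Proof.
split=> [|x y]; first exact: (ratr_nat A 1).
have x_unit := intr_unit_char0 (denq_neq0 x).
have y_unit := intr_unit_char0 (denq_neq0 y).
have hx : x * (denq x)%:~R = (numq x)%:~R by rewrite numqE.
have hy : y * (denq y)%:~R = (numq y)%:~R by rewrite numqE.
apply: (mulIr x_unit); apply: (mulIr y_unit).
transitivity ((ratr x : A) * (denq x)%:~R * (ratr y * (denq y)%:~R)); last by ring.
rewrite (ratr_fracE hx) (ratr_fracE hy) -[LHS]mulrA -!intrM.
by apply: ratr_fracE; rewrite !intrM -hx -hy; ring.
Qed.

(* The library makes ratr a ring morphism only into a numFieldType, which Af is
   not; the alias carries the morphism structure needed here. *)
Definition ratr_char0 : rat -> A := ratr.
HB.instance Definition _ :=
  GRing.isZmodMorphism.Build rat A ratr_char0 ratr_char0_zmod_morphism.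
HB.instance Definition _ :=
  GRing.isMonoidMorphism.Build rat A ratr_char0 ratr_char0_monoid_morphism.

(** * Extension of scalars for the quaternion algebra *)

Section QuatExt.
Variables a b : rat.
Local Notation ext := (@quat_ext A a b).

Lemma quat_ext_zmod_morphism : zmod_morphism ext.
Proof.
move=> x y; rewrite /quat_ext -/ratr_char0 /=.
by congr Quat; exact: (rmorphB ratr_char0).
Qed.

Lemma quat_ext_monoid_morphism : monoid_morphism ext.
Proof.
split=> [|x y]; rewrite /quat_ext -/ratr_char0 /=.
  by rewrite (rmorph0 ratr_char0) (rmorph1 ratr_char0).
rewrite -[RHS]/(quat_mul _ _) /quat_mul /=.
by rewrite !(rmorphD ratr_char0, rmorphN ratr_char0, rmorphM ratr_char0).
Qed.
HB.instance Definition _ := GRing.isZmodMorphism.Build _ _ ext quat_ext_zmod_morphism.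
HB.instance Definition _ := GRing.isMonoidMorphism.Build _ _ ext quat_ext_monoid_morphism.

Lemma quat_extB x y : ext (x - y) = ext x - ext y.
Proof. exact: (rmorphB ext). Qed.
Lemma quat_extM x y : ext (x * y) = ext x * ext y.
Proof. exact: (rmorphM ext). Qed.
Lemma quat_ext1 : ext 1 = 1.
Proof. exact: (rmorph1 ext). Qed.
Lemma quat_extMn x n : ext (x *+ n) = ext x *+ n.
Proof. exact: (rmorphMn ext). Qed.
Lemma quat_extMz x n : ext (x *~ n) = ext x *~ n.
Proof. exact: (rmorphMz ext). Qed.
Lemma quat_ext_sum I (r : seq I) (F : I -> quat a b) :
  ext (\sum_(i <- r) F i) = \sum_(i <- r) ext (F i).
Proof. exact: (rmorph_sum ext). Qed.
Lemma quat_ext_unit x : x \is a GRing.unit -> ext x \is a GRing.unit.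
Proof. exact: (rmorph_unit ext). Qed.
Lemma quat_extV x : x \is a GRing.unit -> ext x^-1 = (ext x)^-1.
Proof. exact: (rmorphV ext). Qed.

(** Reduces questions about the extended algebra to scalars and to four basis elements coming from
    the rational algebra. *)
Lemma quat_ext_coord (y : quat_over A a b) : y =
  q1 y *: ext (Quat 1 0 0 0) + qi y *: ext (Quat 0 1 0 0) +
  (qj y *: ext (Quat 0 0 1 0) + qk y *: ext (Quat 0 0 0 1)).
Proof.
rewrite /quat_ext -/ratr_char0 (rmorph0 ratr_char0) (rmorph1 ratr_char0).
case: y => x1 xi xj xk.
rewrite -[RHS]/(quat_add (quat_add (quat_scale _ _) (quat_scale _ _))
  (quat_add (quat_scale _ _) (quat_scale _ _))).
by rewrite /quat_add /quat_scale /=; congr Quat; ring.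
Qed.
End QuatExt.
End RationalScalars.

Lemma natr_unit_numField (F : numFieldType) n : (n.+1%:R : F) \is a GRing.unit.
Proof. by rewrite unitfE pnatr_eq0. Qed.

(** In p^2 = 2 q^2 the exponent of 2 is even on the left and odd on the right. *)
Lemma sqrtr2_irrational (R : realType) (q : rat) : Num.sqrt (2 : R) <> ratr q.
Proof.
move=> h; have /eqP : (ratr (q ^+ 2) : R) = ratr 2.
  by rewrite rmorphXn /= -h sqr_sqrtr // ratr_nat.
rewrite (inj_eq (fmorph_inj _)) => /eqP q2.
have /eqP : (numq q ^+ 2)%:~R = (2 * denq q ^+ 2)%:~R :> rat.
  by rewrite !expr2 !intrM numqE mulrACA -[q * q]expr2 q2.
rewrite eqr_int => /eqP /(congr1 absz); rewrite abszM !abszX => e.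
have d0 : (0 < `|denq q|)%N by rewrite absz_gt0 denq_neq0.
have := congr1 (logn 2) e.
rewrite lognM ?expn_gt0 ?d0 // !lognX /= => /(congr1 odd).
by rewrite oddD !oddM.
Qed.

(** Modulo (m+2)(n+2) the residue of [z] is a multiple of m+2, and dividing it by m+2 gives the
    component of the quotient modulo n+2. *)
Lemma Zhat_dvd (z : Zhat) m : z m = 0 -> exists w, z = w *+ m.+2.
Proof.
(* Index [n] stands for the modulus n+2, so [k n] is the index of the modulus (m+2)(n+2). *)
move=> z0; pose k n := (m.+2 * n.+2).-2.
have kE n : (k n).+2 = (m.+2 * n.+2)%N by rewrite /k; lia.
have dvd_z n : (m.+2 %| z (k n))%N.
  have d : (m.+2 %| (k n).+2)%N by rewrite kE dvdn_mulr.
  by have := congr1 val (zhatP z d); rewrite z0 /= => /eqP.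
have w_coh : coherent (fun n => inZp (z (k n) %/ m.+2)%N).
  move=> n n' d; apply: val_inj; rewrite /= modn_dvdm //.
  have d' : ((k n').+2 %| (k n).+2)%N by rewrite !kE dvdn_pmul2l.
  have /= <- := congr1 val (zhatP z d'); rewrite (kE n').
  by rewrite -{2}(divnK (dvd_z n)) [(_ * m.+2)%N]mulnC -muln_modr mulKn // modn_mod.
exists (MkZhat w_coh); apply: zhat_inj => n; rewrite -mulr_natr.
have d : (n.+2 %| (k n).+2)%N by rewrite kE dvdn_mull.
rewrite -(zhatP z d); apply: val_inj.
change (val (inZp (z (k n)) : 'I_n.+2) =
  val ((inZp (z (k n) %/ m.+2) : 'I_n.+2) * (m.+2%:R : Zhat) n)).
by rewrite zhat_natE Zp_nat /= modnMm divnK.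
Qed.

(** * The lattice spanned by an order over the profinite integers *)

Lemma quat_scaleAr (A : comNzRingType) (c d : A) (k : A) (x y : quat c d) :
  k *: (x * y) = x * (k *: y).
Proof.
case: x y => [x1 xi xj xk] [y1 yi yj yk].
rewrite /GRing.scale /GRing.mul /= /quat_scale /quat_mul /=; congr Quat; ring.
Qed.

Section Hat.
Variables a b : rat.
Local Notation B := (quat a b).
Local Notation Bf := (quat_over Af a b).
Local Notation extf := (@quat_ext Af a b).
Variable O : set B.
Hypothesis O_order : is_order O.

Lemma order1 : O 1. Proof. by case: O_order. Qed.
Lemma orderM x y : O x -> O y -> O (x * y).
Proof. by case: O_order => _ h _ _ Ox Oy; case: (h x y Ox Oy). Qed.
Lemma order_denom x : exists2 n, (0 < n)%N & O (x *+ n).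
Proof. by case: O_order => _ _ _. Qed.

Lemma hat_ext x : O x -> hat O (extf x).
Proof.
move=> Ox; exists [:: (1, x)]; split=> [p|]; first by rewrite inE => /eqP ->.
by rewrite big_seq1 rmorph1 scale1r.
Qed.

Lemma hat1 : hat O 1.
Proof. by rewrite -(quat_ext1 Af_natr_unit a b); exact/hat_ext/order1. Qed.

Lemma hatD x y : hat O x -> hat O y -> hat O (x + y).
Proof.
move=> [s [sO ->]] [t [tO ->]]; exists (s ++ t); split; last by rewrite big_cat.
by move=> p; rewrite mem_cat => /orP[/sO|/tO].
Qed.

Lemma hat_scale z x : hat O x -> hat O (Zhat_Af z *: x).
Proof.
move=> [s [sO ->]]; exists [seq (z * p.1, p.2) | p <- s]; split.
  by move=> _ /mapP[p /sO ps ->].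
rewrite big_map scaler_sumr; apply: eq_bigr => p _ /=.
by rewrite scalerA rmorphM.
Qed.

Lemma hatB x y : hat O x -> hat O y -> hat O (x - y).
Proof.
move=> xO yO; apply: hatD => //; rewrite -scaleN1r.
by rewrite -(rmorphN1 Zhat_Af); exact: hat_scale.
Qed.

Lemma hatMn x n : hat O x -> hat O (x *+ n).
Proof.
by move=> xO; rewrite -scaler_nat -(rmorph_nat Zhat_Af); exact: hat_scale.
Qed.

Lemma hatM x y : hat O x -> hat O y -> hat O (x * y).
Proof.
move=> [s [sO ->]] [t [tO ->]].
exists [seq (p.1 * q.1, p.2 * q.2) | p <- s, q <- t]; split.
  by move=> _ /allpairsP[[p q] [/sO ps /tO qt ->]]; exact: orderM.
rewrite big_allpairs_dep mulr_suml; apply: eq_bigr => p _.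
rewrite mulr_sumr; apply: eq_bigr => q _ /=.
by rewrite quat_extM -?scalerAl -?quat_scaleAr ?scalerA ?rmorphM //; exact: Af_natr_unit.
Qed.

(** In the standard basis each term is a finite adele z / (n+1) times an element of [B]; the
    denominator n+1 and a denominator of that element relative to [O] are cleared separately. *)
Lemma hat_denom y : exists2 n, (0 < n)%N & hat O (y *+ n).
Proof.
have denomD u v : (exists2 n, (0 < n)%N & hat O (u *+ n)) ->
    (exists2 n, (0 < n)%N & hat O (v *+ n)) ->
    exists2 n, (0 < n)%N & hat O ((u + v) *+ n).
  move=> [m m0 um] [n n0 vn]; exists (m * n)%N; first by rewrite muln_gt0 m0.
  rewrite mulrnDl; apply: hatD; first by rewrite mulrnA; exact: hatMn.
  by rewrite mulnC mulrnA; exact: hatMn.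
have denomZ c x : exists2 n, (0 < n)%N & hat O (c *: extf x *+ n).
  elim/quotW: c => -[z n]; have [m m0 xm] := order_denom x.
  exists (n.+1 * m)%N; first by rewrite muln_gt0.
  have zE : (\pi_(Af)%qT (z, n) : Af) * n.+1%:R = Zhat_Af z.
    rewrite -(rmorph_nat Zhat_Af n.+1).
    change (Af_mul (\pi_(Af)%qT (z, n)) (Zhat_Af n.+1%:R) = Zhat_Af z).
    rewrite !piE; apply/eqmodP; rewrite /= /fa_eq /fa_mul /= !pmul1E.
    by apply/eqP; ring.
  rewrite mulrnA scalerMnl -mulr_natr zE scalerMnr -quat_extMn.
    by apply: hat_scale; exact: hat_ext.
  exact: Af_natr_unit.
rewrite (quat_ext_coord Af_natr_unit y).
by apply: (denomD); apply: (denomD); exact: denomZ.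
Qed.

(** Each element of [O] in the given sum is expanded in the generators, and its integer coordinates
    are absorbed into the [Zhat] coefficients. *)
Lemma hat_coord n (e : 'I_n -> B) :
  O = range (fun c : 'I_n -> int => \sum_i e i *~ c i) ->
  forall y, hat O y -> exists z : 'I_n -> Zhat, y = \sum_i Zhat_Af (z i) *: extf (e i).
Proof.
move=> OE y [s [sO ->]].
elim: s sO => [|p s IH] sO.
  by exists (fun=> 0); rewrite big_nil big1 // => i _; rewrite rmorph0 scale0r.
have [|z zE] := IH; first by move=> q qs; apply: sO; rewrite inE qs orbT.
have : O p.2 by apply: sO; rewrite mem_head.
rewrite OE => -[c _ cE]; exists (fun i => p.1 *~ c i + z i).
rewrite big_cons zE -cE (quat_ext_sum Af_natr_unit) scaler_sumr -big_split /=.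
apply: eq_bigr => i _; rewrite (quat_extMz Af_natr_unit) rmorphD rmorphMz scalerDl.
by rewrite -scalerMzr scalerMzl.
Qed.

(** This is the finiteness of [hat O] modulo m+2: [r] records chosen coordinates modulo m+2, and by
    [Zhat_dvd] equal residues make the differences of coordinates divisible. *)
Lemma hat_mod_finite m : exists (C : finType) (r : Bf -> C),
  forall x y, hat O x -> hat O y -> r x = r y ->
    exists2 w, hat O w & x - y = w *+ m.+2.
Proof.
have [_ _ [n [e OE]] _] := O_order.
have eO i : O (e i).
  rewrite OE; exists (fun j => (j == i)%:Z) => //=.
  rewrite (bigD1 i) //= eqxx mulr1z big1 ?addr0 // => j /negPf ->.
  by rewrite mulr0z.
(* A choice of coordinates, with the dummy value 0 outside [hat O]. *)
pose z y := if pselect (hat O y) is left yO then sval (cid (hat_coord OE yO))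
            else (fun=> 0).
have zP y : hat O y -> y = \sum_i Zhat_Af (z y i) *: extf (e i).
  by rewrite /z; case: pselect => // yO _; exact: (svalP (cid (hat_coord OE yO))).
exists {ffun 'I_n -> 'I_m.+2}, (fun y => [ffun i => z y i m]).
move=> x y xO yO /ffunP exy.
have /choice[w wP] i : exists w, z x i - z y i = w *+ m.+2.
  apply: Zhat_dvd; have := exy i; rewrite !ffunE => h.
  by change (z x i m - z y i m = 0); rewrite h subrr.
exists (\sum_i Zhat_Af (w i) *: extf (e i)).
  elim/big_ind: _ => [||i _]; [|exact: hatD|exact/hat_scale/hat_ext/eO].
  by rewrite -(subrr 1); apply: hatB; exact: hat1.
rewrite {1}(zP _ xO) {1}(zP _ yO) -sumrB -sumrMnl; apply: eq_bigr => i _.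
by rewrite -scalerBl -rmorphB wP rmorphMn scalerMnl.
Qed.

End Hat.

(** * Double cosets and complex structures *)

(** On [S] the map [g] factors through [f], so its image is covered by the finite type [C]. *)
Lemma finite_set_factor T U (C : finType) (S : set T) (f : T -> C) (g : T -> U) :
  (forall v w, S v -> S w -> f v = f w -> g v = g w) -> finite_set (g @` S).
Proof.
move=> fg; have [[v0 Sv0]|S0] := pselect (exists v, S v); last first.
  rewrite (_ : S = set0) ?image_set0 //.
  by rewrite -subset0 => v Sv; apply: S0; exists v.
(* [h] evaluates [g] at a chosen preimage of [c] in [S]; [g v0] is a dummy for values not
   attained. *)
pose h c := if pselect (exists v, S v /\ f v = c) is left e
            then g (sval (cid e)) else g v0.
apply: (sub_finite_set _ (finite_image h (@finite_finset C setT))).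
move=> _ [v Sv <-]; exists (f v) => //; rewrite /h; case: pselect => [e|]; last first.
  by case; exists v.
by case: (svalP (cid e)) => Sw fw; exact: fg.
Qed.

(** Without a collision [f] would be injective, and the preimage of [A], which is all of [nat],
    would be finite. *)
Lemma finite_set_pigeonhole T (A : set T) (f : nat -> T) :
  finite_set A -> (forall n, A (f n)) -> exists i j, (i < j)%N /\ f i = f j.
Proof.
move=> finA A_f; apply: contrapT => f_neq; apply: infinite_nat.
rewrite (_ : setT = f @^-1` A); last by apply/seteqP; split=> // n _; exact: A_f.
apply: finite_preimage => // i j _ _ fij.
by case: (ltngtP i j) => // ij; case: f_neq; [exists i, j|exists j, i].
Qed.

Section DoubleCosets.

(** Inverses are stated by existence, so that the notion makes sense in any [nzRingType], as
    [dcoset] does. *)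
Definition is_subgroup (T : nzRingType) (H : set T) : Prop :=
  [/\ H 1, forall u v, H u -> H v -> H (u * v) &
      forall u, H u -> exists2 v, H v & v * u = 1 /\ u * v = 1].

Lemma dcoset_eqP (T : nzRingType) (H K : set T) x y :
  is_subgroup H -> is_subgroup K ->
  dcoset H K x = dcoset H K y <-> exists h k, [/\ H h, K k & y = h * x * k].
Proof.
move=> [H1 HM HV] [K1 KM KV]; split=> [e|[h [k [Hh Kk ->]]]].
  have : dcoset H K y y by exists 1 => //; exists 1 => //; rewrite mul1r mulr1.
  by rewrite -e => -[h Hh [k Kk <-]]; exists h, k.
apply/seteqP; split=> [_ [h' Hh' [k' Kk' <-]]|_ [h' Hh' [k' Kk' <-]]].
  have [hi Hhi [hih _]] := HV h Hh; have [ki Kki [_ kki]] := KV k Kk.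
  exists (h' * hi); first exact: HM.
  exists (ki * k'); first exact: KM.
  by rewrite !mulrA -(mulrA h' hi h) hih mulr1 -(mulrA _ k ki) kki mulr1.
exists (h' * h); first exact: HM.
by exists (k * k'); [exact: KM|rewrite !mulrA].
Qed.

Lemma is_subgroupX (T U : nzRingType) (H : set T) (K : set U) :
  is_subgroup H -> is_subgroup K -> is_subgroup (H `*` K : set (T * U)%type).
Proof.
move=> [H1 HM HV] [K1 KM KV]; split=> [|[u u'] [v v'] [Hu Ku] [Hv Kv]|[u u'] [/= Hu Ku]].
- by split.
- by split; [exact: HM|exact: KM].
have [v Hv [vu uv]] := HV u Hu; have [v' Kv' [vu' uv']] := KV u' Ku.
exists (v, v'); first by split.
by split; [rewrite -[LHS]/(v * u, v' * u') vu vu'|rewrite -[LHS]/(u * v, u' * v') uv uv'].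
Qed.

Lemma is_subgroup_unitV (T : unitRingType) (H : set T) :
  H 1 -> (forall u v, H u -> H v -> H (u * v)) ->
  (forall u, H u -> u \is a GRing.unit /\ H u^-1) -> is_subgroup H.
Proof.
move=> H1 HM HV; split=> // u Hu; have [u_unit Hui] := HV u Hu.
by exists u^-1 => //; rewrite mulVr // mulrV.
Qed.

End DoubleCosets.

(** * The embedded complex numbers and their centralizer *)

Section Rot.
Variable R : realType.
Local Notation rot := (@Defs.rot R).

Lemma rotM z w : rot (z * w) = rot z * rot w.
Proof. exact: (rot_is_monoid_morphism R).2. Qed.

Lemma rotC z w : rot z * rot w = rot w * rot z.
Proof. by rewrite -!rotM mulrC. Qed.

Lemma rot_real (t : R) : rot t%:C%C = t%:M.
Proof.
apply/matrixP=> i j; rewrite !mxE /=; case: (eqVneq i j) => _ //=.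
by rewrite oppr0; case: ifP.
Qed.

(** Commuting with the image of i alone forces equal diagonal entries and opposite off-diagonal
    ones. *)
Lemma rot_centralizer (k : 'M[R]_2) : (forall z, rot z * k = k * rot z) -> range rot k.
Proof.
move=> /(_ 'i%C) /matrixP Jk.
exists (k 0 0 +i* k 0 1)%C => //.
have := Jk 0 0; rewrite !mxE !big_ord_recl !big_ord0 !mxE /=.
have := Jk 0 1; rewrite !mxE !big_ord_recl !big_ord0 !mxE /=.
rewrite !(mul0r, mulr0, mul1r, mulr1, addr0, add0r, mulrN1).
have -> : lift ord0 ord0 = 1 :> 'I_2 by apply: val_inj.
move=> k11 k10; apply/matrixP=> i j; rewrite !mxE /=.
have I2 (l : 'I_2) : l = 0 \/ l = 1.
  by case: l => [[|[|//]]] ?; [left|right]; apply: val_inj.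
by have [->|->] := I2 i; have [->|->] := I2 j; rewrite //= -?k10 ?opprK ?k11.
Qed.

(** Replaces the explicit matrix shape by a commutation condition, the form in which C-linearity of
    right multiplications arises. *)
Lemma Gamma_infP (k : 'M[R]_2) :
  Gamma_inf k <-> k \is a GRing.unit /\ forall z, rot z * k = k * rot z.
Proof.
split=> [[k_unit [w _ wk]]|[k_unit /rot_centralizer kr]]; last by split.
by split=> // z; rewrite -wk; exact: rotC.
Qed.

Lemma Gamma_inf_subgroup : is_subgroup (@Gamma_inf R).
Proof.
apply: is_subgroup_unitV => [|u v|u].
- by apply/Gamma_infP; split=> [|z]; rewrite ?unitr1 ?mulr1 ?mul1r.
- move=> /Gamma_infP[u_unit uz] /Gamma_infP[v_unit vz]; apply/Gamma_infP.
  split=> [|z]; first by rewrite unitrMl.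
  by rewrite mulrA uz -mulrA vz mulrA.
move=> /Gamma_infP[u_unit uz]; split=> //; apply/Gamma_infP; split=> [|z].
  by rewrite unitrV.
by apply: (mulrI u_unit); rewrite !mulrA mulrV // mul1r -uz mulrK.
Qed.

Lemma mx_mulrnI n : (0 < n)%N -> injective (fun x : 'M[R]_2 => x *+ n).
Proof.
move=> n0 x y; rewrite /= -!scaler_nat; apply: scalerI.
by rewrite pnatr_eq0 -lt0n.
Qed.

(** Scalar matrices are central, so conjugation by [g] fixes them; hence C-linear maps are R-linear
    for the usual structure on matrices. *)
Lemma M2_scale_real (g : 'M[R]_2) (hg : g \is a GRing.unit) (t : R) (v : M2 hg) :
  t%:C%C *: v = (t *: (v : 'M[R]_2) : M2 hg).
Proof.
rewrite -[LHS]/((v : 'M[R]_2) * cplx g _) /cplx rot_real.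
have -> : g^-1 * t%:M * g = t%:M.
  rewrite -[LHS]/(g^-1 *m t%:M *m g) scalar_mxC -mulmxA.
  by rewrite [_^-1 *m g](mulVr hg) mulmx1.
exact: mul_mx_scalar.
Qed.

End Rot.

(** * The rational algebra inside the real matrices *)

Section RationalMatrices.
Variables (R : realType) (a b : rat).
Variable phi : {lrmorphism quat_over R a b -> 'M[R]_2}.
Hypothesis phi_bij : bijective phi.
Local Notation B := (quat a b).
Local Notation natR := (@natr_unit_numField R).
Local Notation pB x := (phi (quat_ext R x)).

Lemma phiM x y : pB (x * y) = pB x * pB y.
Proof. by rewrite (quat_extM natR) rmorphM. Qed.
Lemma phiB x y : pB (x - y) = pB x - pB y.
Proof. by rewrite (quat_extB natR) rmorphB. Qed.
Lemma phi0 : pB 0 = 0.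
Proof. by rewrite -(subrr 1) phiB subrr. Qed.
Lemma phi1 : pB 1 = 1.
Proof. by rewrite (quat_ext1 natR) rmorph1. Qed.
Lemma phiMn x n : pB (x *+ n) = pB x *+ n.
Proof. by rewrite (quat_extMn natR) rmorphMn. Qed.
Lemma phi_unit x : x \is a GRing.unit -> pB x \is a GRing.unit.
Proof. by move=> /(quat_ext_unit natR); exact: rmorph_unit. Qed.
Lemma phiV x : x \is a GRing.unit -> pB x^-1 = (pB x)^-1.
Proof.
by move=> xU; rewrite (quat_extV natR) //; exact/(rmorphV phi)/(quat_ext_unit natR).
Qed.

Lemma phi_inj : injective (fun x : B => pB x).
Proof.
move=> [x1 xi xj xk] [y1 yi yj yk] /(bij_inj phi_bij)[].
by move=> /fmorph_inj-> /fmorph_inj-> /fmorph_inj-> /fmorph_inj->.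
Qed.

Lemma quat_natV n : (0 < n)%N -> exists x : B, x *+ n = 1.
Proof.
move=> n0; exists (n%:R^-1 *: 1); rewrite scalerMnl -[_ *+ n]mulr_natr mulVf ?scale1r //.
by rewrite pnatr_eq0 -lt0n.
Qed.

Definition quat_conj (x : B) : B := Quat (q1 x) (- qi x) (- qj x) (- qk x).

(** The scalar is the reduced norm of [x]. *)
Lemma quat_conjM (x : B) : exists n : rat,
  x * quat_conj x = n *: 1 /\ quat_conj x * x = n *: 1.
Proof.
case: x => x1 xi xj xk.
exists (x1 * x1 - a * (xi * xi) - b * (xj * xj) + a * b * (xk * xk)).
by split; rewrite -[RHS]/(quat_scale _ (quat_one a b)) -[LHS]/(quat_mul _ _);
  rewrite /quat_scale /quat_mul /=; congr Quat; ring.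
Qed.

(** A nonzero reduced norm gives the inverse. If it vanishes, invertibility over the reals makes the
    conjugate of [x], hence [x], zero, which is absurd. *)
Lemma phi_unit_inv (x : B) : pB x \is a GRing.unit -> x \is a GRing.unit.
Proof.
move=> x_unit; have [n [xx' x'x]] := quat_conjM x.
have [n0|n0] := eqVneq n 0; last first.
  apply/unitrP; exists (n^-1 *: quat_conj x); rewrite -scalerAl -quat_scaleAr.
  by rewrite xx' x'x !scalerA mulVf // scale1r.
move: xx'; rewrite n0 scale0r => /(congr1 (fun y => pB y)); rewrite phiM.
rewrite phi0 -(mulr0 (pB x)) => /(mulrI x_unit) x'0.
have x0 : x = 0.
  have : quat_conj x = 0 by apply: phi_inj; rewrite /= x'0 phi0.
  case: x {x_unit x'x x'0} => x1 xi xj xk [-> /eqP + /eqP + /eqP].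
  by rewrite !oppr_eq0 => /eqP-> /eqP-> /eqP->.
by move: x_unit; rewrite x0 phi0 unitr0.
Qed.

(* B has rational coordinates in B (x) R, so v <> 0 and sqrt 2 * v cannot both be
   torsion modulo the image of B. *)
Lemma phi_sqrt2_eq0 (v : 'M[R]_2) x y m n : (0 < m)%N -> (0 < n)%N ->
  pB x = v *+ m -> pB y = Num.sqrt 2 *: v *+ n -> v = 0.
Proof.
move=> m0 n0 xv yv.
have : phi (quat_ext R (y *+ m)) = phi (Num.sqrt 2 *: quat_ext R (x *+ n)).
  by rewrite linearZ /= !phiMn xv yv -!scaler_nat !scalerA; congr (_ *: _); ring.
move=> /(bij_inj phi_bij); move: (y *+ m) => y'.
have [xn0 _|] := eqVneq (x *+ n) 0.
  have := phiMn x n; rewrite xn0 xv => /esym.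
  rewrite phi0 -mulrnA => h.
  by apply: (@mx_mulrnI _ (m * n)); rewrite ?muln_gt0 ?m0 //= h mul0rn.
have irr q q' : ratr q' = Num.sqrt 2 * ratr q :> R -> q = 0.
  move=> h; apply: contrapT => /eqP q0.
  apply: (@sqrtr2_irrational R (q' / q)).
  by rewrite fmorph_div /= h mulfK // fmorph_eq0.
case: y' (x *+ n) => [y1 yi yj yk] [x1 xi xj xk] /eqP x0 [h1 hi hj hk].
by case: x0; congr Quat; [apply: irr h1|apply: irr hi|apply: irr hj|apply: irr hk].
Qed.

End RationalMatrices.

(** * Homomorphisms and isogenies *)

Section IsogenyClass.
Variables (R : realType) (a b : rat).
Variable phi : {lrmorphism quat_over R a b -> 'M[R]_2}.
Hypothesis phi_bij : bijective phi.
Local Notation B := (quat a b).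
Local Notation Bf := (quat_over Af a b).
Local Notation pB x := (phi (quat_ext R x)).
Local Notation ext x := (quat_ext Af x).
Local Notation natf := Af_natr_unit.
Variable O : set B.
Hypothesis O_order : is_order O.
Local Notation QM := (QM phi O).

Lemma idealB (g : Bf) x y : ideal_of O g x -> ideal_of O g y -> ideal_of O g (x - y).
Proof.
move=> [u uO xu] [v vO yv]; exists (u - v); first exact: hatB.
by rewrite (quat_extB natf) xu yv mulrBl.
Qed.

Lemma ideal0 (g : Bf) : ideal_of O g 0.
Proof.
exists 0; last by rewrite mul0r -(subrr 1) (quat_extB natf) subrr.
by rewrite -(subrr 1); apply: hatB => //; exact: hat1.
Qed.

(** If n clears the denominators of g^-1, then n = (n g^-1) g lies in the ideal. *)
Lemma ideal_nat (g : Bf) : g \is a GRing.unit ->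
  exists2 n, (0 < n)%N & ideal_of O g (1 *+ n).
Proof.
move=> gU; have [n n0 gn] := hat_denom O_order g^-1; exists n => //.
by exists (g^-1 *+ n) => //; rewrite (quat_extMn natf) (quat_ext1 natf) mulrnAl mulVr.
Qed.

(** * Right multiplications as endomorphisms *)

Section RightMultiplication.
Variables (g : 'M[R]_2) (hg : g \is a GRing.unit).

(** Conjugation by [g] carries [cplx g] to [rot]. *)
Lemma conj_Gamma_infP (k : 'M[R]_2) : k \is a GRing.unit ->
  Gamma_inf (g * k * g^-1) <-> forall z, cplx g z * k = k * cplx g z.
Proof.
move=> kU; have gkU : g * k * g^-1 \is a GRing.unit by rewrite !unitrMr ?unitrV.
split=> [/Gamma_infP[_ kz] z|kz].
  rewrite /cplx; apply: (mulrI hg); apply: (mulIr (_ : g^-1 \is a GRing.unit)).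
    by rewrite unitrV.
  by have := kz z; rewrite !mulrA mulrV // mul1r mulrK // => ->.
apply/Gamma_infP; split=> // z; have := kz z; rewrite /cplx.
move=> /(congr1 (fun x => g * x * g^-1)); rewrite !mulrA mulrV // mul1r.
by rewrite mulrK.
Qed.

(** A multiple of [c] lies in [O], and [hat O] is stable under right multiplication by [O]. *)
Lemma End0_mulr c : (forall z, cplx g z * pB c = pB c * cplx g z) ->
  End0 O (A := QM hg 1) (fun v : M2 hg => (v : 'M[R]_2) * pB c).
Proof.
move=> cz; have [n n0 cn] := order_denom O_order c; exists n => //; split.
- move=> z u v; change (((u : 'M[R]_2) * cplx g z + v) * pB c *+ n =
    (u * pB c *+ n) * cplx g z + v * pB c *+ n).
  by rewrite mulrDl mulrnDl mulrnAl -[u * _ * _]mulrA cz -[in RHS]mulrA.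
- move=> _ [x [u uO xu] <-] /=; exists (x * c *+ n); last by rewrite phiMn phiM.
  exists (u * ext (c *+ n)); first by apply: hatM => //; exact: hat_ext.
  by rewrite mulr1 -mulrnAr (quat_extM natf) xu mulr1.
- by move=> alpha _ v /=; rewrite mulrnAr mulrA.
Qed.

(** By [End0_mulr], applied to [c] and to its inverse, the lattice condition is automatic and only
    C-linearity remains. *)
Lemma End0_unitsP c : c \is a GRing.unit ->
  End0_units O (A := QM hg 1) (fun v : M2 hg => (v : 'M[R]_2) * pB c) <->
  Gamma_inf (g * pB c * g^-1).
Proof.
move=> cU; rewrite conj_Gamma_infP; last exact: phi_unit.
split=> [[[n n0 [linF _ _]] _] z|cz].
  (* C-linearity at the single vector 1 already gives commutation, once the factor n is
     cancelled. *)
  apply: (@mx_mulrnI R n n0); move: (linF z (1 : 'M[R]_2) 0).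
  change ((1 * cplx g z + 0 : 'M[R]_2) * pB c *+ n =
    (1 * pB c *+ n) * cplx g z + (0 : 'M[R]_2) * pB c *+ n ->
    cplx g z * pB c *+ n = pB c * cplx g z *+ n).
  by rewrite addr0 !mul1r mul0r mul0rn addr0 mulrnAl.
split; first exact: End0_mulr.
have cVz z : cplx g z * pB c^-1 = pB c^-1 * cplx g z.
  have pcU := phi_unit phi cU.
  by rewrite phiV //; apply: (mulrI pcU); rewrite mulrA -cz mulrK // mulVKr.
exists (fun v : M2 hg => (v : 'M[R]_2) * pB c^-1); first exact: End0_mulr.
by split=> v; rewrite -mulrA -phiM ?mulrV ?mulVr // phi1 mulr1.
Qed.

End RightMultiplication.

(** By [End0_unitsP] membership says that the conjugate by [g] is in [Gamma_inf], so the group laws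
    are inherited from there. *)
Lemma End0_Af_subgroup (g : 'M[R]_2) (hg : g \is a GRing.unit) :
  is_subgroup (End0_Af phi O hg 1).
Proof.
have [_ GM GV] := Gamma_inf_subgroup R.
apply: is_subgroup_unitV => [|_ _ [c [cU cE] <-] [d [dU dE] <-]|_ [c [cU cE] <-]].
- exists 1; last exact: quat_ext1 natf _ _.
  split; first exact: unitr1.
  apply/End0_unitsP; first exact: unitr1.
  by rewrite phi1 mulr1 mulrV //; case: (Gamma_inf_subgroup R).
- have cdU : c * d \is a GRing.unit by rewrite unitrMr.
  exists (c * d); last exact: (quat_extM natf).
  split=> //; apply/End0_unitsP => //.
  move: cE dE => /End0_unitsP-/(_ cU) cG /End0_unitsP-/(_ dU) dG.
  by have := GM _ _ cG dG; rewrite phiM !mulrA mulrVK.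
split; first exact: (quat_ext_unit natf).
have cVU : c^-1 \is a GRing.unit by rewrite unitrV.
exists c^-1; last exact: (quat_extV natf).
split=> //; apply/End0_unitsP => //.
move: cE => /End0_unitsP-/(_ cU) /GV[v vG [vc _]].
rewrite (_ : g * _ * _ = v) //.
have pcU := phi_unit phi cU.
have uU : g * pB c * g^-1 \is a GRing.unit by rewrite !unitrMr ?unitrV.
apply: (mulIr uU); rewrite vc phiV // !mulrA mulrVK // mulrVK // mulrV //.
Qed.

(** The isogeny is multiplication by an n that clears the denominators of [gf]. Its kernel is finite
    because [hat O] has finitely many classes modulo a common multiple. *)
Lemma isogeny_mulrn (g : 'M[R]_2) (hg : g \is a GRing.unit) (gf : Bf) :
  gf \is a GRing.unit -> isogenous O (QM hg gf) (QM hg 1).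
Proof.
move=> gfU; have [n n0 gn] := hat_denom O_order gf.
have [m m0 gm] := hat_denom O_order gf^-1.
have [nu nuE] := quat_natV a b n0.
exists (fun v : M2 hg => v *+ n); split.
- split.
  + by move=> z u v; rewrite mulrnDl scalerMnr.
  + move=> _ [x [u uO xu] <-] /=; exists (x *+ n); last exact: phiMn.
    exists (u * (gf *+ n)); first exact: hatM.
    by rewrite (quat_extMn natf) xu mulr1 mulrnAr.
  + by move=> alpha _ v /=; rewrite [RHS]mulrnAr.
- move=> y; exists ((y : 'M[R]_2) * pB nu : M2 hg).
  rewrite -[_ - _]/((y : 'M[R]_2) - y * pB nu *+ n).
  rewrite -mulrnAr -phiMn nuE phi1 mulr1 subrr.
  by exists 0; [exact: ideal0|exact: phi0].
(* If [m] clears the denominators of gf^-1, an element of [B] in nm [hat O] becomes a period for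
   [gf] after division by n. The factor 2 keeps the modulus at least 2. *)
have [C [r rP]] := hat_mod_finite O_order (2 * n * m).-2.
have kE : (2 * n * m).-2.+2 = (2 * n * m)%N by lia.
pose S := [set v : 'M[R]_2 | exists2 x, hat O (ext x) & pB x = v *+ n].
pose rep v := if pselect (S v) is left Sv then s2val (cid2 Sv) else 0.
have repP v : S v -> hat O (ext (rep v)) /\ pB (rep v) = v *+ n.
  by rewrite /rep; case: pselect => // Sv _; split;
    [exact: (s2valP (cid2 Sv))|exact: (s2valP' (cid2 Sv))].
(* The coset of a kernel point v depends only on the residue class of nv. *)
apply: (@finite_set_factor _ _ C _ (fun v : M2 hg => r (ext (rep v)))) => v w.
have inS u : @period _ _ (QM hg 1) (u *+ n) -> S u.
  by move=> [x [y yO xy] xu]; exists x; rewrite // xy mulr1.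
move=> /inS/repP[vO vE] /inS/repP[wO wE] /rP => /(_ vO wO)[y yO vwy].
have vwP : @period _ _ (QM hg gf) (v - w).
  exists ((rep v - rep w) * nu); last first.
    by rewrite /= phiM phiB vE wE -mulrnBl mulrnAl -mulrnAr -phiMn nuE phi1 mulr1.
  exists (y * (gf^-1 *+ m) *+ 2); first by apply/hatMn/hatM.
  rewrite (quat_extM natf) (quat_extB natf) vwy kE.
  rewrite (_ : 2 * n * m = m * 2 * n)%N; last by lia.
  rewrite mulrnA [LHS]mulrnAl -[LHS]mulrnAr -(quat_extMn natf) nuE (quat_ext1 natf) mulr1.
  by rewrite [y * _]mulrnAr -[in RHS]mulrnA [RHS]mulrnAl -mulrA mulVr // mulr1.
have periodB u1 u2 : @period _ _ (QM hg gf) u1 -> @period _ _ (QM hg gf) u2 ->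
    @period _ _ (QM hg gf) (u1 - u2).
  by move=> [x xI <-] [x' x'I <-]; exists (x - x'); [exact: idealB|exact: phiB].
have period0 : @period _ _ (QM hg gf) 0 by exists 0; [exact: ideal0|exact: phi0].
apply/seteqP; split=> [_ [l lP <-]|_ [l lP <-]].
  exists (l - (0 - (v - w))); first by apply: (periodB) => //; exact: (periodB).
  by rewrite sub0r opprK; rewrite addrCA [w + _]addrC subrK addrC.
exists (l - (v - w)); first exact: periodB.
by rewrite opprB addrCA [v + _]addrC subrK addrC.
Qed.

(** * Homomorphisms compatible with the order *)

Section Homomorphisms.
Variables (g1 g2 : 'M[R]_2) (hg1 : g1 \is a GRing.unit) (hg2 : g2 \is a GRing.unit).
Variables gf1 gf2 : Bf.
Variable F : M2 hg1 -> M2 hg2.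

(** [F] is R-linear and commutes with [B], which spans the real matrices, so it is left linear over
    them and determined by its value at 1. *)
Lemma hom_mulr : is_hom O (A := QM hg1 gf1) (A' := QM hg2 gf2) F ->
  forall v, F v = (v : 'M[R]_2) * F (1 : 'M[R]_2).
Proof.
move=> [linF _ comF].
have F0 : F 0 = 0.
  have := linF 1 0 0; rewrite !scale1r addr0 => e.
  by apply: (addrI (F 0)); rewrite addr0 -e.
have FD u v : F (u + v) = F u + F v.
  by have := linF 1 u v; rewrite !scale1r.
have FZ z u : F (z *: u) = z *: F u.
  by have := linF z u 0; rewrite F0 !addr0.
have FR (t : R) (u : 'M[R]_2) : F (t *: u) = t *: (F u : 'M[R]_2).
  by have := FZ t%:C%C u; rewrite !M2_scale_real.
(* Some multiple of [x] lies in [O]; the integer factor comes out by R-linearity and is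
   cancelled. *)
have FB (x : B) (u : 'M[R]_2) : F (pB x * u) = pB x * (F u : 'M[R]_2).
  have [n n0 xn] := order_denom O_order x.
  apply: (@mx_mulrnI R n n0); have := comF _ xn u; rewrite /= !phiMn.
  by rewrite !mulrnAl -[pB x * u *+ n]scaler_nat FR scaler_nat.
move=> v; have [phiV _ phiK] := phi_bij.
rewrite -{1}(phiK v) -{2}(phiK v); move: (phiV v) => y.
rewrite (quat_ext_coord (@natr_unit_numField R) y) !raddfD /= !linearZ /=.
rewrite !mulrDl !FD -!scalerAl.
by congr (_ + _ + (_ + _)); rewrite -FB -FR mulr1.
Qed.

Lemma isogeny_quat : gf1 \is a GRing.unit ->
  is_isogeny O (A := QM hg1 gf1) (A' := QM hg2 gf2) F ->
  exists c : B, [/\ c \is a GRing.unit, forall v, F v = (v : 'M[R]_2) * pB c &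
    forall z, cplx g1 z * pB c = pB c * cplx g2 z].
Proof.
move=> gf1U [Fhom _ Ffin]; have FE := hom_mulr Fhom; have [linF perF _] := Fhom.
have mU : (F (1 : 'M[R]_2) : 'M[R]_2) \is a GRing.unit.
  (* If m were singular, some nonzero v would satisfy v m = 0, and the whole real line through v
     would lie in the kernel of [F]. *)
  apply: contrapT => mNU; set m := F _ in FE mNU *.
  pose v : 'M[R]_2 := kermx m.
  have v0 : v <> 0.
    by move=> /eqP; rewrite kermx_eq0 row_free_unit.
  have vm : v * m = 0 by exact: mulmx_ker.
  (* The multiples of tv meet only finitely many cosets of the lattice, so two of them differ by a
     period. Taking t = 1 and t = sqrt 2 contradicts [phi_sqrt2_eq0]. *)
  have tors (t : R) : exists2 n, (0 < n)%N & exists x : B, pB x = t *: v *+ n.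
    pose f (k : nat) := [set (t *: v *+ k : M2 hg1) + l | l in @period _ _ (QM hg1 gf1)].
    have [k|i [j [ij fij]]] := finite_set_pigeonhole (f := f) Ffin.
      exists (t *: v *+ k) => //=; rewrite FE mulrnAl -scalerAl vm scaler0 mul0rn.
      by exists 0; [exact: ideal0|exact: phi0].
    have : f j (t *: v *+ j) by exists 0; [exists 0; [exact: ideal0|exact: phi0]|exact: addr0].
    rewrite -fij => -[_ [x _ <-] e].
    exists (j - i)%N; first by rewrite subn_gt0.
    by exists x; rewrite mulrnBr 1?ltnW // -e addrC addKr.
  have [i i0 [x xE]] := tors 1; have [j j0 [y yE]] := tors (Num.sqrt 2).
  by apply: v0; apply: (phi_sqrt2_eq0 phi_bij (x := x) i0 j0 _ yE); rewrite xE scale1r.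
(* An integer n of the source lattice has image nm in the target lattice, hence in [B]; then m is
   obtained by dividing by n. *)
have [n n0 nI] := ideal_nat gf1U; have [nu nuE] := quat_natV a b n0.
have [|x _ xE] := perF (pB (1 *+ n)); first by exists (1 *+ n).
have mE : F (1 : 'M[R]_2) = pB (x * nu).
  rewrite phiM [pB x]xE [F (pB _)]FE phiMn phi1 mulr_natl mulrnAl -mulrnAr -phiMn nuE phi1.
  by rewrite mulr1.
rewrite mE in mU FE.
exists (x * nu); split=> //; first exact: phi_unit_inv mU.
move=> z; move: (linF z (1 : 'M[R]_2) 0); rewrite !FE.
change ((1 * cplx g1 z + 0 : 'M[R]_2) * pB (x * nu) =
  1 * pB (x * nu) * cplx g2 z + (0 : 'M[R]_2) * pB (x * nu) ->
  cplx g1 z * pB (x * nu) = pB (x * nu) * cplx g2 z).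
by rewrite addr0 !mul1r mul0r addr0.
Qed.

End Homomorphisms.
End IsogenyClass.

(** * Points of the Shimura curve *)

Section ShimuraPoints.
Variables (R : realType) (a b : rat).
Variable phi : {lrmorphism quat_over R a b -> 'M[R]_2}.
Local Notation B := (quat a b).
Local Notation Bf := (quat_over Af a b).
Local Notation pB x := (phi (quat_ext R x)).
Local Notation ext x := (quat_ext Af x).

Lemma GQ_subgroup : is_subgroup (GQ phi).
Proof.
split=> [|_ _ [x xU <-] [y yU <-]|_ [x xU <-]].
- exists 1; first exact: unitr1.
  by rewrite phi1 (quat_ext1 Af_natr_unit).
- exists (x * y); first by rewrite /= unitrMr.
  by rewrite phiM (quat_extM Af_natr_unit).
exists (pB x^-1, ext x^-1); first by exists x^-1; rewrite //= unitrV.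
rewrite -[_ * _]/(pB x^-1 * pB x, ext x^-1 * ext x).
rewrite -[X in _ /\ X = _]/(pB x * pB x^-1, ext x * ext x^-1).
rewrite -!phiM -!(quat_extM Af_natr_unit) mulVr // mulrV //.
by rewrite phi1 (quat_ext1 Af_natr_unit).
Qed.

Lemma X_pointP (G : set Bf) : is_subgroup G ->
  forall g gf g' gf', X_point phi G (g, gf) = X_point phi G (g', gf') <->
    exists k u x, [/\ Gamma_inf k, G u, x \is a GRing.unit,
      g' = k * g * pB x & gf' = u * gf * ext x].
Proof.
move=> G_sub g gf g' gf'.
rewrite /X_point (dcoset_eqP _ _ (is_subgroupX (Gamma_inf_subgroup R) G_sub) GQ_subgroup).
split=> [[[k u] [_ [[kG uG] [x xU <-] [-> ->]]]]|[k [u [x [kG uG xU -> ->]]]]].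
  by exists k, u, x.
by exists (k, u), (pB x, ext x); split=> //; exists x.
Qed.

Lemma open_subgroup_is_subgroup (O : set B) (G : set Bf) :
  open_subgroup O G -> is_subgroup G.
Proof.
move=> [GO G1 GM GV _]; apply: is_subgroup_unitV => // u Gu.
by case: (GO u Gu) => uU _; split; [|exact: GV].
Qed.

End ShimuraPoints.

Theorem proposition3p3
  (R : realType) (a b : rat) (ha : a != 0) (hb : b != 0)
  (phi : {lrmorphism quat_over R a b -> 'M[R]_2}) (hphi : bijective phi)
  (O : set (quat a b)) (hO : maximal_order O)
  (Gam : set (quat_over Af a b)) (hGam : open_subgroup O Gam)
  (ginf : 'M[R]_2) (hg : ginf \is a GRing.unit) :
  let P := X_point phi Gam (ginf, 1) in
  let E := End0_Af phi O hg 1 in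
  let GAf := [set gf : quat_over Af a b | gf \is a GRing.unit] in
  exists psi : set (quat_over Af a b) -> set ('M[R]_2 * quat_over Af a b),
    (forall gf, GAf gf -> psi (dcoset Gam E gf) = X_point phi Gam (ginf, gf)) /\
    set_bij (dcosets Gam E GAf) (isogeny_class phi O Gam P) psi.
Proof.
move=> P E GAf; have [O_order _] := hO.
have Gam_sub := open_subgroup_is_subgroup hGam.
have E_sub : is_subgroup E by exact: End0_Af_subgroup.
have [G1 GM GV] := Gamma_inf_subgroup R.
(* From left to right this is well-definedness of the map, from right to left its injectivity. *)
have classP gf gf' : dcoset Gam E gf = dcoset Gam E gf' <->
    X_point phi Gam (ginf, gf) = X_point phi Gam (ginf, gf').
  rewrite dcoset_eqP // X_pointP //.
  split=> [[u [_ [uG [c [cU /End0_unitsP cE] <-] ->]]]|[k [u [x [kG uG xU gE ->]]]]].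
    (* [k] is the inverse of the conjugate of [c], chosen so that k ginf c = ginf. *)
    have [k kG [kc _]] := GV _ (cE O_order cU).
    exists k, u, c; split=> //; apply: (mulIr (_ : ginf^-1 \is a GRing.unit)).
      by rewrite unitrV.
    by rewrite mulrV // -kc !mulrA.
  (* The real components give ginf = k ginf x, so the conjugate of [x] by [ginf] is the inverse of
     [k]. *)
  exists u, (quat_ext Af x); split=> //; exists x => //; split=> //.
  apply/End0_unitsP => //; have [k' k'G [k'k _]] := GV _ kG.
  rewrite (_ : _ * _ = k') //; rewrite [in X in _ * X]gE.
  have -> : ginf * phi (quat_ext R x) = k' * ginf.
    by rewrite [in RHS]gE !mulrA k'k mul1r.
  by rewrite -gE mulrK.
(* [psi] picks a unit representative of [D], with dummy value 1 if there is none; [classP] makes the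
   choice immaterial. *)
pose psi (D : set (quat_over Af a b)) : set ('M[R]_2 * quat_over Af a b) :=
  X_point phi Gam (ginf, xget 1 [set gf | GAf gf /\ dcoset Gam E gf = D]).
have psiE gf : GAf gf -> psi (dcoset Gam E gf) = X_point phi Gam (ginf, gf).
  move=> gfU; rewrite /psi; case: xgetP => [gf' _ [_ /classP //]|/(_ gf)[]].
  by split.
exists psi; split=> //; split.
- move=> _ [gf gfU <-]; rewrite psiE //.
  by exists ginf, hg, 1, ginf, hg, gf; split=> //; [exact: unitr1|exact: isogeny_mulrn].
- move=> _ _ /set_mem[gf gfU <-] /set_mem[gf' gfU' <-].
  by rewrite !psiE // => /classP.
move=> _ [g1 [hg1 [gf1 [g2 [hg2 [gf2 [gf1U P1 gf2U -> [F]]]]]]]].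
move=> /(isogeny_quat hphi O_order gf2U)[c [cU _ cz]].
move: P1 => /(X_pointP phi Gam_sub)[k [u [x [kG uG xU g1E _]]]].
have pcU := phi_unit phi cU; have pxU := phi_unit phi xU.
pose k' := g2 * phi (quat_ext R c) * g1^-1.
have k'G : Gamma_inf k'.
  apply/Gamma_infP; split=> [|z]; first by rewrite /k' !unitrMr ?unitrV.
  have := congr1 (fun m => g2 * m * g1^-1) (cz z); rewrite /k' /cplx !mulrA.
  by rewrite mulrV // mul1r mulrK.
have gf'U : gf2 * quat_ext Af c * quat_ext Af x^-1 \is a GRing.unit.
  by rewrite !unitrMr //; apply: (quat_ext_unit Af_natr_unit); rewrite ?unitrV.
(* From g1 = k ginf x and k' = g2 c g1^-1 follows g2 = (k' k) ginf (x c^-1); cancelling x c^-1 on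
   the finite side leaves gf2 c x^-1. *)
exists (dcoset Gam E (gf2 * quat_ext Af c * quat_ext Af x^-1)).
  by exists (gf2 * quat_ext Af c * quat_ext Af x^-1).
rewrite psiE //; apply/(X_pointP phi Gam_sub).
exists (k' * k), 1, (x * c^-1); split.
- exact: GM.
- by case: Gam_sub.
- by rewrite unitrMr ?unitrV.
- rewrite phiM phiV // !mulrA -(mulrA k') -(mulrA k') -g1E /k'.
  by rewrite mulrVK // mulrK.
rewrite mul1r -!mulrA -!(quat_extM Af_natr_unit) mulKr // mulrV //.
by rewrite (quat_ext1 Af_natr_unit) mulr1.
Qed.
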